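(* Let $\&$ be a continuous t-norm on $[0,1]$ and $\mathcal{Q}=([0,1],\&,1)$. Then every flat complete ${\sf D}(\mathcal{Q})$-category is Yoneda complete.
   Context: A continuous t-norm $\&$ on $[0,1]$ is a continuous, associative, commutative, monotone binary operation with unit $1$ (equivalently, $([0,1],\&,1)$ is a divisible quantale). Its implication is $a\rightarrow b=\bigvee\{c\in[0,1]\mid a\& c\leq b\}$. Throughout $\bigvee,\bigwedge,\wedge$ are suprema, infima and binary minimum in $[0,1]$ (with $\bigvee\emptyset=0$, $\bigwedge\emptyset=1$). A ${\sf D}(\mathcal{Q})$-category (ordered fuzzy set valued in $\mathcal{Q}$) $\mathbb{A}$ is a set $\mathbb{A}_0$ with a map $\mathbb{A}:\mathbb{A}_0\times\mathbb{A}_0\to[0,1]$ such that $\mathbb{A}(x,y)\leq\mathbb{A}(x,x)\wedge\mathbb{A}(y,y)$ and $(\mathbb{A}(y,y)\rightarrow\mathbb{A}(y,z))\&\mathbb{A}(x,y)\leq\mathbb{A}(x,z)$ for all $x,y,z\in\mathbb{A}_0$. The type of $x$ is $\mathbb{A}(x,x)$. A weight $\phi$ on $\mathbb{A}$ of type $t\phi\in[0,1]$ is a map $\phi:\mathbb{A}_0\to[0,1]$ (together with the number $t\phi$) such that $\phi(x)\leq\mathbb{A}(x,x)\wedge t\phi$ and $(\mathbb{A}(y,y)\rightarrow\phi(y))\&\mathbb{A}(x,y)\leq\phi(x)$ for all $x,y$. A coweight $\psi$ on $\mathbb{A}$ of type $t\psi\in[0,1]$ is a map $\psi:\mathbb{A}_0\to[0,1]$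 (together with $t\psi$) such that $\psi(x)\leq\mathbb{A}(x,x)\wedge t\psi$ and $(\mathbb{A}(x,x)\rightarrow\mathbb{A}(x,y))\&\psi(x)\leq\psi(y)$ for all $x,y$. For a weight $\phi$ and a coweight $\psi$, put $\phi\circ\psi=\bigvee_{x\in\mathbb{A}_0}(\mathbb{A}(x,x)\rightarrow\phi(x))\&\psi(x)$. A weight $\phi$ is flat if (i) for all $b\in[0,1]$, $\phi\circ(b\wedge t)=b\wedge t\phi$, where $b\wedge t$ is the coweight of type $b$ given by $x\mapsto b\wedge\mathbb{A}(x,x)$; and (ii) $\phi\circ(\psi_1\wedge\psi_2)=(\phi\circ\psi_1)\wedge(\phi\circ\psi_2)$ for all coweights $\psi_1,\psi_2$ of the same type (with $\psi_1\wedge\psi_2$ the pointwise minimum). A supremum of a weight $\phi$ is an element $s\in\mathbb{A}_0$ with $\mathbb{A}(s,s)=t\phi$ and $\mathbb{A}(s,y)=\mathbb{A}(y,y)\wedge\big(\big(\bigwedge_{x\in\mathbb{A}_0}(\phi(x)\rightarrow\mathbb{A}(x,y))\big)\& t\phi\big)$ for all $y\in\mathbb{A}_0$. $\mathbb{A}$ is flat complete if every flat weight on $\mathbb{A}$ has a supremum. A net $\{x_\lambda\}$ in $\mathbb{A}$ (i.e. in $\mathbb{A}_0$) is forward Cauchy if $\bigvee_\lambda\bigwedge_{\nu\geq\mu\geq\lambda}\mathbb{A}(x_\mu,x_\nu)=\bigwedge_\lambda\bigvee_{\nu\geq\mu\geq\lambda}\mathbb{A}(x_\mu,x_\nu)$.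 An element $x\in\mathbb{A}_0$ is a Yoneda limit of a net $\{x_\lambda\}$ if $\mathbb{A}(x,x)=\bigvee_\lambda\bigwedge_{\sigma\geq\lambda}\mathbb{A}(x_\sigma,x_\sigma)$ and $\mathbb{A}(x,y)=\bigvee_\lambda\bigwedge_{\sigma\geq\lambda}\mathbb{A}(x_\sigma,y)$ for all $y\in\mathbb{A}_0$. $\mathbb{A}$ is Yoneda complete if every forward Cauchy net in $\mathbb{A}$ has a Yoneda limit. *)

(* Defs.v *)
From mathcomp Require Import all_boot all_order all_algebra.
From mathcomp Require Import all_classical all_reals all_analysis.
Set Implicit Arguments.
Unset Strict Implicit.
Unset Printing Implicit Defensive.
Import Order.TTheory GRing.Theory Num.Theory numFieldNormedType.Exports.
Local Open Scope classical_set_scope.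
Local Open Scope ring_scope.

(* The quantale [0,1] is the interval `[0, 1] of an arbitrary realType R: its
   elements are reals constrained to lie in that interval, and a binary
   operation on [0,1] is a function R -> R -> R whose values outside the unit
   square are irrelevant. *)

(* Suprema and infima computed in [0,1], for S `<=` `[0, 1]. Adjoining 0 (resp.
   1) does not affect nonempty S, and gives the conventions \/ set0 = 0 and
   /\ set0 = 1 (whereas the library has inf set0 = 0). *)
Definition isup (R : realType) (S : set R) : R := sup (0 |` S).
Definition iinf (R : realType) (S : set R) : R := inf (1 |` S).

Record continuous_tnorm (R : realType) (op : R -> R -> R) : Prop := {
  tnorm_itv : forall a b, a \in `[0, 1] -> b \in `[0, 1] ->
    op a b \in `[0, 1];
  tnormA : forall a b c, a \in `[0, 1] -> b \in `[0, 1] -> c \in `[0, 1] ->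
    op a (op b c) = op (op a b) c;
  tnormC : forall a b, a \in `[0, 1] -> b \in `[0, 1] -> op a b = op b a;
  tnorm_le : forall a a' b b', a \in `[0, 1] -> a' \in `[0, 1] ->
    b \in `[0, 1] -> b' \in `[0, 1] ->
    a <= a' -> b <= b' -> op a b <= op a' b';
  tnorm1 : forall a, a \in `[0, 1] -> op a 1 = a;
  tnorm_continuous :
    {within (`[0, 1] `*` `[0, 1] : set (R * R)), continuous (fun p => op p.1 p.2)}
}.

Definition impl (R : realType) (op : R -> R -> R) (a b : R) : R :=
  isup [set c | c \in `[0, 1] /\ op a c <= b].

Record DQcat (R : realType) (op : R -> R -> R) := {
  obj :> Type;
  hom : obj -> obj -> R;
  hom_itv : forall x y, hom x y \in `[0, 1];
  hom_le : forall x y, hom x y <= Num.min (hom x x) (hom y y);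
  hom_comp : forall x y z,
    op (impl op (hom y y) (hom y z)) (hom x y) <= hom x z
}.

Section Weights.
Variables (R : realType) (op : R -> R -> R) (A : DQcat op).

Record is_weight (phi : A -> R) (t : R) : Prop := {
  weight_type_itv : t \in `[0, 1];
  weight_itv : forall x, phi x \in `[0, 1];
  weight_le : forall x, phi x <= Num.min (hom x x) t;
  weight_comp : forall x y, op (impl op (hom y y) (phi y)) (hom x y) <= phi x
}.

Record is_coweight (psi : A -> R) (t : R) : Prop := {
  coweight_type_itv : t \in `[0, 1];
  coweight_itv : forall x, psi x \in `[0, 1];
  coweight_le : forall x, psi x <= Num.min (hom x x) t;
  coweight_comp : forall x y, op (impl op (hom x x) (hom x y)) (psi x) <= psi y
}.

Definition wcomp (phi psi : A -> R) : R :=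
  isup (range (fun x => op (impl op (hom x x) (phi x)) (psi x))).

Record flat_weight (phi : A -> R) (t : R) : Prop := {
  flat_is_weight : is_weight phi t;
  flat_const : forall b, b \in `[0, 1] ->
    wcomp phi (fun x => Num.min b (hom x x)) = Num.min b t;
  flat_min : forall psi1 psi2 s, is_coweight psi1 s -> is_coweight psi2 s ->
    wcomp phi (fun x => Num.min (psi1 x) (psi2 x)) =
    Num.min (wcomp phi psi1) (wcomp phi psi2)
}.

Definition is_supremum (phi : A -> R) (t : R) (s : A) : Prop :=
  hom s s = t /\
  forall y, hom s y =
    Num.min (hom y y)
      (op (iinf (range (fun x => impl op (phi x) (hom x y)))) t).

End Weights.

Definition flat_complete (R : realType) (op : R -> R -> R) (A : DQcat op) :
    Prop :=
  forall (phi : A -> R) (t : R), flat_weight phi t ->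
    exists s, is_supremum phi t s.

Record directed (D : Type) (le : D -> D -> Prop) : Prop := {
  directed_inhabited : inhabited D;
  directed_refl : forall d, le d d;
  directed_trans : forall d e f, le d e -> le e f -> le d f;
  directed_ub : forall d e, exists f, le d f /\ le e f
}.

Section Nets.
Variables (R : realType) (op : R -> R -> R) (A : DQcat op).
Variables (D : Type) (le : D -> D -> Prop) (u : D -> A).

Definition tail_homs (l : D) : set R :=
  [set r | exists m n, [/\ le l m, le m n & r = hom (u m) (u n)]].

Definition forward_cauchy : Prop :=
  isup (range (fun l => iinf (tail_homs l))) =
  iinf (range (fun l => isup (tail_homs l))).

Definition is_yoneda_limit (x : A) : Prop :=
  hom x x =
    isup (range (fun l => iinf [set hom (u s) (u s) | s in [set s | le l s]])) /\
  forall y, hom x y =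
    isup (range (fun l => iinf [set hom (u s) y | s in [set s | le l s]])).

End Nets.

Definition yoneda_complete (R : realType) (op : R -> R -> R) (A : DQcat op) :
    Prop :=
  forall (D : Type) (le : D -> D -> Prop) (u : D -> A),
    directed le -> forward_cauchy le u -> exists x, is_yoneda_limit le u x.

(* Main.v *)
From mathcomp Require Import all_boot all_order all_algebra.
From mathcomp Require Import all_classical all_reals all_analysis.
From mathcomp Require Import lra.
Require Import Defs.
Set Implicit Arguments.
Unset Strict Implicit.
Unset Printing Implicit Defensive.
Import Order.TTheory GRing.Theory Num.Theory numFieldNormedType.Exports.
Local Open Scope classical_set_scope.
Local Open Scope ring_scope.

(** A forward Cauchy net [u] determines the weight
    [phi x = liminf_s hom x (u s)], whose type is the value [t] at which the
    hom-values of the tails of [u] settle; in particular the types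
    [hom (u s) (u s)] converge to [t].  The theorem follows once [phi] is known
    to be flat and its suprema are known to be Yoneda limits of [u].

    Flatness comes from evaluating [phi] against coweights by the formula
    [wcomp phi psi = liminf_s psi (u s)] (lemma [limit_weight_wcomp]).  The
    right-hand side preserves binary minima of [psi], because finitely many
    eventual properties hold simultaneously in a directed set
    ([liminf_min]), and it sends [min b hom] to [min b t].

    If [x] is a supremum of [phi], then [hom x y] is given by the residuals
    [phi z -> hom z y].  Taking [z = u s], where [phi (u s)] approaches [t],
    bounds [hom x y] above by [L = liminf_s hom (u s) y].  Conversely the
    composites of [hom z (u s)] with [hom (u s) y] are all below [hom z y], and
    in the limit so is the composite of [phi z] with [L]
    ([supremum_yoneda_limit]).

    Two properties of a continuous t-norm are used throughout.  Divisibility,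
    [b <= a -> a & (a -> b) = b] ([tnorm_impl]), makes composition symmetric:
    [(q -> a) & b = a & (q -> b)] for [a, b <= q] ([impl_tnorm_swap]).  Uniform
    continuity on the unit square ([tnorm_modulus]) replaces the limit
    arguments: the residuum [q -> a] need not be continuous in [q], so one
    cannot let [q = hom (u s) (u s)] tend to [t] inside it; instead [a] is written as
    [q & (q -> a)] and only the outer [q] is moved, with an error bounded
    independently of the residuum. *)

(** * Uniform continuity on compact sets *)

(** A real function that is continuous on a compact set, only relative to that
    set, is uniformly continuous there.  The near-covering form of compactness
    is applied to the filter of radii decreasing to 0. *)
Lemma heine_cantor (R : realType) (T : pseudoMetricType R) (K : set T) (f : T -> R) :
  compact K -> {within K, continuous f} ->
  forall e : R, 0 < e -> exists2 d : R, 0 < d &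
    forall x y, K x -> K y -> ball x d y -> `|f x - f y| < e.
Proof.
move=> /compact_near_coveringP Kc fc e e0.
have H : forall x, K x -> \forall x' \near x & d \near (0:R)^'+,
   (K x' -> forall y, K y -> ball x' d y -> `|f x' - f y| < e).
  move=> x Kx.
  have /(_ _ (nbhsx_ballx (f x) (e / 2) (divr_gt0 e0 (ltr0n _ 2)))) := fc x.
  rewrite /nbhs /= -nbhs_subspace_in // => /nbhs_ballP[r /= r0 rf].
  exists (ball x (r / 2), [set d | 0 < d < r / 2]).
    split; first by apply: nbhsx_ballx; rewrite divr_gt0.
    near=> d => /=; apply/andP; split; near: d.
      exact: nbhs_right_gt.
    by apply: nbhs_right_lt; rewrite divr_gt0.
  move=> [x' d] /= [xx' /andP[d0 dr]] Kx' y Ky x'y.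
  have h1 : ball (f x) (e / 2) (f x').
    by apply: rf => //; apply: le_ball xx'; rewrite ler_pdivrMr // ler_peMr ?ler1n// ltW.
  have h2 : ball (f x) (e / 2) (f y).
    apply: rf => //; rewrite (splitr r); apply: ball_triangle xx' _.
    exact: le_ball (ltW dr) _ x'y.
  rewrite (splitr e); have := ball_splitr h1 h2.
  by rewrite -splitr.
have N := Kc _ _ (fun d x => K x -> forall y, K y -> ball x d y -> `|f x - f y| < e) _ H.
near (0:R)^'+ => d.
have dP : K `<=` (fun x => K x -> forall y, K y -> ball x d y -> `|f x - f y| < e).
  by near: d; exact: N.
have d0 : 0 < d by [].
by exists d => // x y Kx; apply: dP.
Unshelve. all: by end_near. Qed.

(** * Suprema and infima in the unit interval *)

Section UnitInterval.
Context {R : realType}.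
Implicit Types (S : set R) (x c e : R).

Lemma in01P x : reflect (0 <= x /\ x <= 1) (x \in `[0, 1]).
Proof. by rewrite in_itv /=; exact: andP. Qed.

Let isup_has_sup S : S `<=` `[0, 1] -> has_sup (0 |` S).
Proof.
move=> SI; split; first by exists 0; left.
by exists 1 => x [->//|/SI /in01P[]].
Qed.

Lemma isup_ub S x : S `<=` `[0, 1] -> S x -> x <= isup S.
Proof. by move=> SI Sx; apply: sup_upper_bound; [exact: isup_has_sup|right]. Qed.

Lemma isup_le S c : 0 <= c -> (forall x, S x -> x <= c) -> isup S <= c.
Proof.
move=> c0 Sc; apply: ge_sup; first by exists 0; left.
by move=> x [->//|/Sc].
Qed.

Lemma isup_itv S : S `<=` `[0, 1] -> isup S \in `[0, 1].
Proof.
move=> SI; apply/in01P; split; last by apply: isup_le => // x /SI /in01P[].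
by apply: sup_upper_bound; [exact: isup_has_sup|left].
Qed.

(** The first alternative accounts for the element 0 adjoined by [isup]. *)
Lemma isup_adherent S e : 0 < e -> S `<=` `[0, 1] ->
  isup S <= e \/ exists2 x, S x & isup S - e < x.
Proof.
move=> e0 SI; have [x [->|Sx] xe] := sup_adherent e0 (isup_has_sup SI).
  by left; rewrite -subr_le0 ltW.
by right; exists x.
Qed.

Let iinf_has_inf S : S `<=` `[0, 1] -> has_inf (1 |` S).
Proof.
move=> SI; split; first by exists 1; left.
by exists 0 => x [->//|/SI /in01P[]].
Qed.

Lemma iinf_lb S x : S `<=` `[0, 1] -> S x -> iinf S <= x.
Proof.
by move=> SI Sx; apply: ge_inf; [case: (iinf_has_inf SI)|right].
Qed.

Lemma le_iinf S c : c <= 1 -> (forall x, S x -> c <= x) -> c <= iinf S.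
Proof.
move=> c0 Sc; apply: lb_le_inf; first by exists 1; left.
by move=> x [->//|/Sc].
Qed.

Lemma iinf_itv S : S `<=` `[0, 1] -> iinf S \in `[0, 1].
Proof.
move=> SI; apply/in01P; split; first by apply: le_iinf => // x /SI /in01P[].
by apply: ge_inf; [case: (iinf_has_inf SI)|left].
Qed.

(** The first alternative accounts for the element 1 adjoined by [iinf]. *)
Lemma iinf_adherent S e : 0 < e -> S `<=` `[0, 1] ->
  1 <= iinf S + e \/ exists2 x, S x & x < iinf S + e.
Proof.
move=> e0 SI; have [x [->|Sx] xe] := inf_adherent e0 (iinf_has_inf SI).
  by left; exact: ltW.
by right; exists x.
Qed.

Lemma min01 x y : x \in `[0, 1] -> y \in `[0, 1] -> Num.min x y \in `[0, 1].
Proof. by move=> xI yI; have [_|_] := leP x y. Qed.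
End UnitInterval.

(** * Continuous t-norms and their residua *)

Section Tnorm.
Context {R : realType} {op : R -> R -> R}.
Hypothesis opT : continuous_tnorm op.
Implicit Types a b c d q : R.

(** Monotonicity turns uniform continuity into a one-sided estimate, which
    composes with inequalities and needs no lower bound on [a] and [b]: replace
    [a, b] by the minima of [a, a'] and [b, b'], which are close to [a, b] and
    below [a', b']. *)
Lemma tnorm_modulus e : 0 < e -> exists2 d, 0 < d &
  forall a a' b b', a \in `[0, 1] -> a' \in `[0, 1] ->
    b \in `[0, 1] -> b' \in `[0, 1] ->
    a <= a' + d -> b <= b' + d -> op a b <= op a' b' + e.
Proof.
move=> e0.
have cI : compact (`[0, 1] `*` `[0, 1] : set (R * R)).
  by apply: compact_setX; exact: segment_compact.
have [d d0 dP] := heine_cantor cI (tnorm_continuous opT) e0.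
exists (d / 2); first by rewrite divr_gt0.
move=> a a' b b' aI a'I bI b'I aa' bb'.
pose m := Num.min a a'; pose n := Num.min b b'.
have mI : m \in `[0, 1] by exact: min01.
have nI : n \in `[0, 1] by exact: min01.
have near_min x x' : x <= x' + d / 2 -> `|x - Num.min x x'| < d.
  move=> xx'; rewrite ger0_norm ?subr_ge0 ?ge_min ?lexx//.
  by have [_|_] := leP x x'; lra.
have : `|op a b - op m n| < e.
  by apply: (dP (a, b) (m, n)) => //=; split; apply: near_min.
move=> /(le_lt_trans (ler_norm _)) h.
have : op m n <= op a' b' by apply: (tnorm_le opT) => //; rewrite ge_min lexx orbT.
by move: h; lra.
Qed.

Lemma tnorm_ler a b c : a \in `[0, 1] -> b \in `[0, 1] -> c \in `[0, 1] ->
  b <= c -> op a b <= op a c.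
Proof. by move=> ? ? ? bc; apply: (tnorm_le opT). Qed.

Lemma one01 : (1 : R) \in `[0, 1].
Proof. by apply/in01P; rewrite ler01 lexx. Qed.

Lemma tnorm_lel1 a b : a \in `[0, 1] -> b \in `[0, 1] -> op a b <= a.
Proof.
move=> aI bI; rewrite -[leRHS](tnorm1 opT) //.
by apply: tnorm_ler => //; [exact: one01|case/in01P: bI].
Qed.

Lemma tnorm_ler1 a b : a \in `[0, 1] -> b \in `[0, 1] -> op a b <= b.
Proof. by move=> aI bI; rewrite (tnormC opT) // tnorm_lel1. Qed.

Let impl_set a b : [set c | c \in `[0, 1] /\ op a c <= b] `<=` `[0, 1].
Proof. by move=> c []. Qed.

Lemma impl_itv a b : impl op a b \in `[0, 1].
Proof. exact/isup_itv/impl_set. Qed.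
Hint Resolve impl_itv : core.

Lemma le_impl a b c : c \in `[0, 1] -> op a c <= b -> c <= impl op a b.
Proof. by move=> cI acb; apply: isup_ub => //; exact: impl_set. Qed.

(** Continuity from the left: the residuum itself satisfies the inequality of
    which it is the supremum of solutions. *)
Lemma tnorm_impl_le a b : a \in `[0, 1] -> b \in `[0, 1] ->
  op a (impl op a b) <= b.
Proof.
move=> aI bI; apply/ler_addgt0Pr => e e0.
have [d d0 dP] := tnorm_modulus e0.
have d0' : 0 <= d by exact: ltW.
have [small|[c [cI acb] cd]] := isup_adherent d0 (@impl_set a b).
  (* A residuum of size at most d is compared with 0, using op a 0 <= 0. *)
  have zI : (0 : R) \in `[0, 1] by apply/in01P; rewrite lexx ler01.
  apply: (le_trans (dP a a _ 0 _ _ _ _ _ _)) => //; rewrite ?lerDl// ?add0r//.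
  rewrite lerD2r; apply: le_trans (tnorm_ler1 aI zI) _.
  by case/in01P: bI.
apply: (le_trans (dP a a _ c _ _ _ _ _ _)) => //; rewrite ?lerDl// ?lerD2r//.
by rewrite -lerBlDr ltW.
Qed.

(** Divisibility.  An argument slightly above the residuum violates
    [op a c <= b], so continuity from the right gives the missing inequality;
    if there is no room above the residuum then it is close to the unit. *)
Lemma tnorm_impl a b : a \in `[0, 1] -> b \in `[0, 1] -> b <= a ->
  op a (impl op a b) = b.
Proof.
move=> aI bI ba; apply/eqP; rewrite eq_le tnorm_impl_le //=.
apply/ler_addgt0Pr => e e0.
have [d d0 dP] := tnorm_modulus e0.
have /in01P[r0 r1] := impl_itv a b.
have [le1|lt1] := leP 1 (impl op a b + d).
  rewrite (le_trans ba) // -[leLHS](tnorm1 opT) //.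
  by apply: dP => //; [exact: one01|rewrite lerDl ltW].
have cI : impl op a b + d \in `[0, 1] by apply/in01P; split; lra.
have [acb|bac] := leP (op a (impl op a b + d)) b.
  by have := le_impl cI acb; lra.
by rewrite (le_trans (ltW bac)) //; apply: dP => //; rewrite lerDl ltW.
Qed.

(** Both sides equal [q & (q -> a) & (q -> b)]: composition through an object
    of type [q] can put the residual on either factor. *)
Lemma impl_tnorm_swap q a b : q \in `[0, 1] -> a \in `[0, 1] -> b \in `[0, 1] ->
  a <= q -> b <= q -> op (impl op q a) b = op a (impl op q b).
Proof.
move=> qI aI bI aq bq.
rewrite -{1}(tnorm_impl qI bI bq) (tnormA opT) //.
by rewrite [op _ q](tnormC opT) // tnorm_impl.
Qed.
End Tnorm.

(** * Lower limits along directed sets *)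

Section Liminf.
Context {R : realType} {D : Type} {le : D -> D -> Prop}.
Hypothesis leD : directed le.
Implicit Types (f g : D -> R) (P Q : D -> Prop).

Definition eventually P := exists l, forall s, le l s -> P s.

Definition liminf f : R :=
  isup (range (fun l => iinf [set f s | s in [set s | le l s]])).

Lemma eventually_mono P Q : (forall s, P s -> Q s) -> eventually P -> eventually Q.
Proof. by move=> PQ [l lP]; exists l => s /lP /PQ. Qed.

Lemma eventuallyT P : (forall s, P s) -> eventually P.
Proof. by move=> PT; case: (directed_inhabited leD) => l; exists l => s _. Qed.

Lemma eventuallyI P Q : eventually P -> eventually Q ->
  eventually (fun s => P s /\ Q s).
Proof.
move=> [l lP] [m mQ]; have [n [ln mn]] := directed_ub leD l m.
by exists n => s ns; split; [apply: lP|apply: mQ]; apply: directed_trans ns.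
Qed.

Lemma eventually_ex P : eventually P -> exists s, P s.
Proof. by move=> [l lP]; exists l; apply: lP; exact: directed_refl. Qed.

Let tail01 f l : (forall s, f s \in `[0, 1]) ->
  [set f s | s in [set s | le l s]] `<=` `[0, 1].
Proof. by move=> fI _ [s _ <-]; exact: fI. Qed.

Let tails01 f : (forall s, f s \in `[0, 1]) ->
  range (fun l => iinf [set f s | s in [set s | le l s]]) `<=` `[0, 1].
Proof. by move=> fI _ [l _ <-]; apply/iinf_itv/tail01. Qed.

Lemma liminf_itv f : (forall s, f s \in `[0, 1]) -> liminf f \in `[0, 1].
Proof. by move=> fI; apply/isup_itv/tails01. Qed.

Lemma liminf_approx f e : (forall s, f s \in `[0, 1]) -> 0 < e ->
  eventually (fun s => liminf f <= f s + e).
Proof.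
move=> fI e0; have [small|[_ [l _ <-] lf]] := isup_adherent e0 (tails01 fI).
  apply: eventuallyT => s; apply: le_trans small _.
  by rewrite lerDr; case/in01P: (fI s).
exists l => s ls; rewrite -lerBlDr (le_trans (ltW lf)) //.
by apply: iinf_lb; [exact: tail01|exists s].
Qed.

(** Together with [liminf_approx] this characterises [liminf] by eventual
    inequalities up to an error. *)
Lemma le_liminf f c : (forall s, f s \in `[0, 1]) ->
  (forall e, 0 < e -> eventually (fun s => c <= f s + e)) -> c <= liminf f.
Proof.
move=> fI cf; apply/ler_addgt0Pr => e e0; have [l lP] := cf _ e0.
rewrite -lerBlDr.
apply: (@le_trans _ _ (iinf [set f s | s in [set s | le l s]])).
  apply: le_iinf => [|_ [s ls <-]]; rewrite lerBlDr; last exact: lP.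
  have /lP := directed_refl leD l; have /in01P[_ ?] := fI l; lra.
by apply: isup_ub; [exact: tails01|exists l].
Qed.

Lemma liminf_le f c : (forall s, f s \in `[0, 1]) ->
  (forall e, 0 < e -> eventually (fun s => f s <= c + e)) -> liminf f <= c.
Proof.
move=> fI fc; apply/ler_addgt0Pr => e e0.
have e2 : 0 < e / 2 by rewrite divr_gt0.
have [s []] := eventually_ex (eventuallyI (fc _ e2) (liminf_approx fI e2)).
lra.
Qed.

Lemma liminf_min f g : (forall s, f s \in `[0, 1]) -> (forall s, g s \in `[0, 1]) ->
  liminf (fun s => Num.min (f s) (g s)) = Num.min (liminf f) (liminf g).
Proof.
move=> fI gI; have mI s : Num.min (f s) (g s) \in `[0, 1] by exact: min01.
apply/eqP; rewrite eq_le le_min -andbA; apply/and3P; split.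
- apply: le_liminf => // e e0.
  apply: eventually_mono (liminf_approx mI e0) => s /le_trans; apply.
  by rewrite lerD2r ge_min lexx.
- apply: le_liminf => // e e0.
  apply: eventually_mono (liminf_approx mI e0) => s /le_trans; apply.
  by rewrite lerD2r ge_min lexx orbT.
apply: le_liminf => // e e0.
apply: eventually_mono (eventuallyI (liminf_approx fI e0)
  (liminf_approx gI e0)) => s [hf hg].
by have [_|_] := leP (f s) (g s); rewrite ge_min; apply/orP; [left|right].
Qed.

Lemma liminf_cst c : c \in `[0, 1] -> liminf (fun=> c) = c.
Proof.
move=> cI; apply/eqP; rewrite eq_le; apply/andP; split.
  by apply: liminf_le => // e e0; apply: eventuallyT => s; rewrite lerDl ltW.
by apply: le_liminf => // e e0; apply: eventuallyT => s; rewrite lerDl ltW.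
Qed.

(** By continuity in the first argument, [op (liminf f) c] is almost below
    [op (f s) c] as soon as [liminf f] is almost below [f s]. *)
Lemma tnorm_liminf_le op f g c : continuous_tnorm op ->
  (forall s, f s \in `[0, 1]) -> (forall s, g s \in `[0, 1]) -> c \in `[0, 1] ->
  eventually (fun s => op (f s) c <= g s) -> op (liminf f) c <= liminf g.
Proof.
move=> opT fI gI cI fg; apply: le_liminf => // e e0.
have [d d0 dP] := tnorm_modulus opT e0.
apply: eventually_mono (eventuallyI fg (liminf_approx fI d0)) => s [h fs].
apply: le_trans (_ : op (f s) c + e <= _); last by rewrite lerD2r.
by apply: dP => //; [exact: liminf_itv|rewrite lerDl ltW].
Qed.
End Liminf.

(** * Coweights *)

Section YonedaLimit.
Context {R : realType} {op : R -> R -> R} {A : DQcat op}.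
Hypothesis opT : continuous_tnorm op.
Implicit Types x y : A.

Let homI := @hom_itv R op A.
Let implI := @impl_itv R op.
Hint Resolve homI implI : core.

Lemma hom_lel x y : hom x y <= hom x x.
Proof. by have := hom_le x y; rewrite le_min => /andP[]. Qed.

Lemma hom_ler x y : hom x y <= hom y y.
Proof. by have := hom_le x y; rewrite le_min => /andP[]. Qed.

Lemma min_coweight (psi1 psi2 : A -> R) t :
  is_coweight psi1 t -> is_coweight psi2 t ->
  is_coweight (fun x => Num.min (psi1 x) (psi2 x)) t.
Proof.
move=> [tI I1 le1 c1] [_ I2 le2 c2]; split => // x.
- exact: min01.
- by rewrite ge_min le1.
move=> y; rewrite le_min; apply/andP; split.
  apply: le_trans (c1 x y); apply: tnorm_ler => //; first exact: min01.
  by rewrite ge_min lexx.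
apply: le_trans (c2 x y); apply: tnorm_ler => //; first exact: min01.
by rewrite ge_min lexx orbT.
Qed.

Lemma const_coweight b : b \in `[0, 1] ->
  is_coweight (fun x : A => Num.min b (hom x x)) b.
Proof.
move=> bI; split => // x; first exact: min01.
  by rewrite minC.
move=> y; have mI : Num.min b (hom x x) \in `[0, 1] by exact: min01.
rewrite le_min; apply/andP; split.
  by apply: le_trans (tnorm_ler1 opT _ _) _ => //; rewrite ge_min lexx.
apply: le_trans (hom_ler x y).
rewrite -[leRHS](tnorm_impl opT (homI x x) (homI x y) (hom_lel x y)).
rewrite [leRHS](tnormC opT) //.
by apply: tnorm_ler => //; rewrite ge_min lexx orbT.
Qed.

(** * The weight of a forward Cauchy net *)

Context {D : Type} {le : D -> D -> Prop} {u : D -> A}.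
Hypothesis leD : directed le.
Hypothesis uC : forward_cauchy le u.

Let tail_itv l : tail_homs le u l `<=` `[0, 1].
Proof. by move=> _ [m [n [_ _ ->]]]; exact: homI. Qed.

(** By the Cauchy condition this is also the upper limit of the same values;
    it is the type of the weight below. *)
Definition cauchy_value : R := isup (range (fun l => iinf (tail_homs le u l))).
Local Notation t := cauchy_value.

Lemma cauchy_value_itv : t \in `[0, 1].
Proof. by apply: isup_itv => _ [l _ <-]; apply/iinf_itv/tail_itv. Qed.
Let tI := cauchy_value_itv.
Hint Resolve tI : core.

Lemma cauchy_ge e : 0 < e ->
  eventually (le := le) (fun m => forall n, le m n -> t <= hom (u m) (u n) + e).
Proof.
move=> e0; have [||small|[_ [l _ <-] lt]] := @isup_adherent _
    (range (fun l => iinf (tail_homs le u l))) e.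
- by [].
- by move=> _ [l _ <-]; apply/iinf_itv/tail_itv.
- apply: eventuallyT => // m n _; apply: le_trans small _.
  by rewrite lerDr; case/in01P: (homI (u m) (u n)).
exists l => m lm n mn; rewrite -lerBlDr (le_trans (ltW lt)) //.
by apply: iinf_lb; [exact: tail_itv|exists m, n].
Qed.

Lemma cauchy_le e : 0 < e ->
  eventually (le := le) (fun m => forall n, le m n -> hom (u m) (u n) <= t + e).
Proof.
rewrite /t uC => e0; have [||big|[_ [l _ <-] lt]] := @iinf_adherent _
    (range (fun l => isup (tail_homs le u l))) e.
- by [].
- by move=> _ [l _ <-]; apply/isup_itv/tail_itv.
- apply: eventuallyT => // m n _; apply: le_trans big.
  by case/in01P: (homI (u m) (u n)).
exists l => m lm n mn; apply: le_trans (ltW lt).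
by apply: isup_ub; [exact: tail_itv|exists m, n].
Qed.

Lemma cauchy_liminf : liminf (le := le) (fun s => hom (u s) (u s)) = t.
Proof.
apply/eqP; rewrite eq_le; apply/andP; split.
  apply: liminf_le => // e /cauchy_le; apply: eventually_mono => s; apply.
  exact: directed_refl.
apply: le_liminf => // e /cauchy_ge; apply: eventually_mono => s; apply.
exact: directed_refl.
Qed.

(** The candidate for the weight presented by [u]: a lower limit of the
    representable weights at the points of the net. *)
Definition limit_weight x : R := liminf (le := le) (fun s => hom x (u s)).
Local Notation phi := limit_weight.

Lemma limit_weight_itv x : phi x \in `[0, 1].
Proof. exact: liminf_itv. Qed.
Let phiI := limit_weight_itv.
Hint Resolve phiI : core.

Lemma limit_weight_le x : phi x <= hom x x.
Proof.
by apply: liminf_le => // e e0; apply: eventuallyT => // s;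
  rewrite (le_trans (hom_lel _ _)) // lerDl ltW.
Qed.

Lemma limit_weight_le_cauchy x : phi x <= t.
Proof.
rewrite -cauchy_liminf; apply: le_liminf => // e e0.
apply: eventually_mono (liminf_approx leD (fun s => homI x (u s)) e0).
by move=> s /le_trans; apply; rewrite lerD2r hom_ler.
Qed.

(** With [limit_weight_le_cauchy], [phi (u s)] tends to [t].  The Cauchy
    condition is needed here for pairs of distinct indices: [phi (u s)] is
    governed by the values [hom (u s) (u n)] at all later [n]. *)
Lemma eventually_le_limit_weight e : 0 < e ->
  eventually (le := le) (fun s => t <= phi (u s) + e).
Proof.
move=> e0; apply: eventually_mono (cauchy_ge e0) => m mP.
rewrite -lerBlDr; apply: le_liminf => // d d0.
by exists m => n mn; have := mP _ mn; lra.
Qed.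

Lemma limit_weight_is_weight : is_weight phi t.
Proof.
split => // x.
  by rewrite le_min limit_weight_le limit_weight_le_cauchy.
move=> y; rewrite (impl_tnorm_swap opT) ?limit_weight_le ?hom_ler//.
apply: (tnorm_liminf_le leD opT) => //; apply: eventuallyT => // s.
rewrite -(impl_tnorm_swap opT) ?hom_lel ?hom_ler//.
exact: hom_comp.
Qed.

(** Evaluating a coweight at the limit weight means taking its lower limit
    along the net.  That [wcomp phi psi] is at most this limit is the coweight
    axiom applied at [u s].  For the reverse, the term of [wcomp phi psi] at
    [u s] is [phi (u s) & (q -> psi (u s))] with [q = hom (u s) (u s)], and it
    is close to [q & (q -> psi (u s)) = psi (u s)] because [phi (u s)] and [q]
    are both close to [t]. *)
Lemma limit_weight_wcomp (psi : A -> R) b : is_coweight psi b ->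
  wcomp phi psi = liminf (le := le) (fun s => psi (u s)).
Proof.
move=> [_ psiI psi_le psi_comp].
have psi_hom x : psi x <= hom x x by have := psi_le x; rewrite le_min => /andP[].
have compI x : op (impl op (hom x x) (phi x)) (psi x) \in `[0, 1].
  exact: (tnorm_itv opT).
apply/eqP; rewrite eq_le; apply/andP; split.
  apply: isup_le => [|_ [x _ <-]].
    by have /in01P[] : liminf (le := le) (fun s => psi (u s)) \in `[0, 1]
      by exact: liminf_itv.
  rewrite (impl_tnorm_swap opT) ?limit_weight_le//.
  apply: (tnorm_liminf_le leD opT) => //; apply: eventuallyT => // s.
  rewrite -(impl_tnorm_swap opT) ?hom_lel//; exact: psi_comp.
apply: liminf_le => // e e0; have [d d0 dP] := tnorm_modulus opT e0.
have d2 : 0 < d / 2 by rewrite divr_gt0.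
apply: eventually_mono (eventuallyI leD (cauchy_le d2)
  (eventually_le_limit_weight d2)) => s [/(_ _ (directed_refl leD s)) qs ts].
apply: (@le_trans _ _ (op (phi (u s)) (impl op (hom (u s) (u s)) (psi (u s))) + e)).
  rewrite -{1}(tnorm_impl opT (homI (u s) (u s)) (psiI _) (psi_hom _)).
  by apply: dP => //; [lra|rewrite lerDl ltW].
rewrite lerD2r -(impl_tnorm_swap opT) ?limit_weight_le//.
by apply: isup_ub => [_ [x _ <-]|]; [exact: compI|exists (u s)].
Qed.

(** * Flatness and the supremum *)

Lemma limit_weight_flat : flat_weight phi t.
Proof.
split; first exact: limit_weight_is_weight.
  move=> b bI; rewrite (limit_weight_wcomp (const_coweight bI)).
  by rewrite (liminf_min leD) // liminf_cst // cauchy_liminf.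
move=> psi1 psi2 s w1 w2.
rewrite (limit_weight_wcomp (min_coweight w1 w2)) (limit_weight_wcomp w1).
rewrite (limit_weight_wcomp w2) (liminf_min leD) // => d.
  exact: (coweight_itv w1).
exact: (coweight_itv w2).
Qed.

(** The delicate half is [L <= hom x y], where [L = liminf hom (u s) y].
    It amounts to [phi z & (t -> L) <= hom z y], that is, to [d & L <= hom z y]
    with [d = t -> phi z].  For suitable [s], with [q = hom (u s) (u s)] and
    [k = q -> hom (u s) y], up to arbitrarily small errors
    [d & L <= d & (q & k) <= (t & d) & k = phi z & k <= hom z (u s) & k], and
    the last term is at most [hom z y] by composition in [A]. *)
Lemma supremum_yoneda_limit x : is_supremum phi t x -> is_yoneda_limit le u x.
Proof.
move=> [xt xP]; split; first by rewrite xt -cauchy_liminf.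
move=> y; rewrite -[RHS]/(liminf (le := le) (fun s => hom (u s) y)).
set L := liminf _; rewrite xP.
have LI : L \in `[0, 1] by exact: liminf_itv.
have resid01 : range (fun z => impl op (phi z) (hom z y)) `<=` `[0, 1].
  by move=> _ [z _ <-]; exact: implI.
have iI := iinf_itv resid01.
have Lt : L <= t.
  rewrite -cauchy_liminf; apply: le_liminf => // e e0.
  apply: eventually_mono (liminf_approx leD (fun s => homI (u s) y) e0).
  by move=> s /le_trans; apply; rewrite lerD2r hom_lel.
apply/eqP; rewrite eq_le; apply/andP; split.
  rewrite ge_min; apply/orP; right.
  (* Bound the infimum of residuals by the single residual at u s. *)
  apply: le_liminf => // e e0; have [d d0 dP] := tnorm_modulus opT e0.
  apply: eventually_mono (eventually_le_limit_weight d0) => s ts.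
  apply: (@le_trans _ _ (op (phi (u s)) (impl op (phi (u s)) (hom (u s) y)) + e)).
    rewrite (tnormC opT) //; apply: dP => //.
    apply: (@le_trans _ _ (impl op (phi (u s)) (hom (u s) y))).
      by apply: iinf_lb => //; exists (u s).
    by rewrite lerDl ltW.
  by rewrite lerD2r tnorm_impl_le.
rewrite le_min; apply/andP; split.
  apply: liminf_le => // e e0; apply: eventuallyT => // s.
  by rewrite (le_trans (hom_ler _ _)) // lerDl ltW.
rewrite (tnormC opT) // -{1}(tnorm_impl opT tI LI Lt).
apply: tnorm_ler => //; apply: le_iinf => [|_ [z _ <-]].
  by case/in01P: (implI t L).
(* Move the residual off L, where a lower bound is available. *)
apply: le_impl => //; rewrite -(impl_tnorm_swap opT) ?limit_weight_le_cauchy//.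
set d := impl op t (phi z).
apply/ler_addgt0Pr => e e0; have e3 : 0 < e / 3 by rewrite divr_gt0.
have [r r0 rP] := tnorm_modulus opT e3.
have ev := eventuallyI leD (cauchy_le r0) (eventuallyI leD
   (liminf_approx leD (fun s => homI z (u s)) r0)
   (liminf_approx leD (fun s => homI (u s) y) r0)).
have [s [/(_ _ (directed_refl leD s)) qs [zs sy]]] := eventually_ex leD ev.
set q := hom (u s) (u s) in qs.
set k := impl op q (hom (u s) y).
have qI : q \in `[0, 1] by exact: homI.
have dI : d \in `[0, 1] by exact: implI.
have kI : k \in `[0, 1] by exact: implI.
have dkI : op d k \in `[0, 1] by exact: (tnorm_itv opT).
have rl a : a <= a + r by rewrite lerDl ltW.
have h1 : op d L <= op d (op q k) + e / 3.
  rewrite [op q k](tnorm_impl opT) ?hom_lel//.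
  exact: rP.
have h2 : op d (op q k) <= op (phi z) k + e / 3.
  rewrite -[phi z](tnorm_impl opT tI (phiI z) (limit_weight_le_cauchy z)) -/d.
  rewrite (tnormA opT) // [op d q](tnormC opT) // -!(tnormA opT) //.
  exact: rP.
have h3 : op (phi z) k <= hom z y + e / 3.
  apply: (@le_trans _ _ (op (hom z (u s)) k + e / 3)).
    exact: rP.
  rewrite lerD2r (tnormC opT) //.
  exact: hom_comp.
lra.
Qed.
End YonedaLimit.

Theorem theorem6p1 (R : realType) (op : R -> R -> R)
  (op_tnorm : continuous_tnorm op) (A : DQcat op) :
  flat_complete A -> yoneda_complete A.
Proof.
move=> Afc D le u leD uC.
have [x xs] := Afc _ _ (limit_weight_flat op_tnorm leD uC).
by exists x; exact: supremum_yoneda_limit xs.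
Qed.
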